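(* Let $k\geq1$, $l\geq 0$ (so $k+l\geq1$), and let $S=sgp^+\langle a,b\mid a^kb^l=b^l\rangle$. Then $S$ is prefix-automatic if and only if $l\leq1$.
   Context: $sgp^+\langle A\mid R\rangle$ is the free semigroup $A^+$ of nonempty words modulo the congruence generated by $R$; $b^0$ is the empty word $\varepsilon$. Automaticity: regular = accepted by a finite automaton. With $\$\notin A$, $A(2,\$)=(A\cup\{\$\})^2\setminus\{(\$,\$)\}$; $(\alpha,\beta)\delta_A^R$ is the word over $A(2,\$)$ obtained by padding the shorter word on the right with $\$$'s and reading letter pairs. For a semigroup $S$ generated by finite $A$, $\phi:A^+\to S$ canonical, $L\subseteq A^+$ regular with $\phi(L)=S$, write $\alpha=\beta$ if $\phi(\alpha)=\phi(\beta)$ and $L_a^\$=\{(\alpha,\beta)\delta^R_A:\alpha,\beta\in L,\alpha a=\beta\}$ for $a\in A\cup\{\varepsilon\}$. $S$ is automatic if some such $(A,L)$ has all $L_a^\$$ regular; prefix-automatic if some such automatic structure also has $\{(\alpha,\beta)\delta_A^R:\alpha\in L,\beta\in\mathrm{Pref}(L),\alpha=\beta\}$ regular ($\mathrm{Pref}(L)$ = prefixes of words of $L$). A monoid is prefix-automatic if it is so as a semigroup. *)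

(* Defs.v *)
From mathcomp Require Import all_boot.
Set Implicit Arguments. Unset Strict Implicit. Unset Printing Implicit Defensive.

Definition regular (S : finType) (L : seq S -> Prop) : Prop :=
  exists (Q : finType) (q0 : Q) (d : Q -> S -> Q) (F : pred Q),
    forall w, L w <-> F (foldl d q0 w).

(** Right padding: (u,v)delta^R, letters of A(2,$) encoded as pairs of
    [option A], [None] playing the role of the padding symbol $. *)
Definition padR (A : Type) (u v : seq A) : seq (option A * option A) :=
  mkseq (fun i => (nth None (map Some u) i, nth None (map Some v) i))
        (maxn (size u) (size v)).

(** Semigroups are given as a carrier [T] with a product [op], and equality
    in the semigroup is the relation [E] (a congruence); i.e. we work with the
    quotient semigroup T/E. *)
Section Automatic.
Variables (T : Type) (op : T -> T -> T) (E : T -> T -> Prop).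
Variables (A : finType) (gen : A -> T).

Definition phi (w : seq A) : option T :=
  match w with
  | [::] => None
  | x :: u => Some (foldl (fun t a => op t (gen a)) (gen x) u)
  end.

Definition eqS (s t : option T) : Prop :=
  match s, t with Some s, Some t => E s t | _, _ => False end.

Definition wordeq (u v : seq A) : Prop := eqS (phi u) (phi v).

Definition appl (u : seq A) (a : option A) : seq A :=
  if a is Some x then rcons u x else u.

(** L_a^$ for a in A cup {eps} (a = None encodes eps) *)
Definition Lpad (L : seq A -> Prop) (a : option A) (w : seq (option A * option A)) : Prop :=
  exists u v, [/\ L u, L v, wordeq (appl u a) v & w = padR u v].

Definition prefL (L : seq A -> Prop) (p : seq A) : Prop := exists s, L (p ++ s).

Definition Lpref (L : seq A -> Prop) (w : seq (option A * option A)) : Prop :=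
  exists u p, [/\ L u, prefL L p, wordeq u p & w = padR u p].

Definition automatic_structure (L : seq A -> Prop) : Prop :=
  [/\ forall w, L w -> w <> [::],
      regular L,
      (forall t : T, exists w, L w /\ eqS (phi w) (Some t))
    & forall a : option A, regular (Lpad L a)].
End Automatic.

(** S is prefix-automatic: for some finite generating set A of S (the map
    [gen] is injective in S, i.e. A is a subset of S) and some regular
    L subseteq A^+ mapping onto S, all L_a^$ and the prefix language are regular. *)
Definition prefix_automatic (T : Type) (op : T -> T -> T) (E : T -> T -> Prop) : Prop :=
  exists (A : finType) (gen : A -> T),
    (forall x y, E (gen x) (gen y) -> x = y) /\
    exists L : seq A -> Prop,
      automatic_structure op E gen L /\ regular (Lpref op E gen L).

Inductive cong (X : Type) (R : seq X -> seq X -> Prop) : seq X -> seq X -> Prop :=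
| cong_refl u : cong R u u
| cong_sym u v : cong R u v -> cong R v u
| cong_trans u v w : cong R u v -> cong R v w -> cong R u w
| cong_step p q r s : R p q -> cong R (r ++ p ++ s) (r ++ q ++ s).

(** Alphabet {a, b} encoded as bool: a = true, b = false. *)
Definition relS (k l : nat) (u v : seq bool) : Prop :=
  u = nseq k true ++ nseq l false /\ v = nseq l false.

(** Nonempty words x :: w encoded as pairs (x, w); product = concatenation. *)
Definition Scar : Type := (bool * seq bool)%type.
Definition Sop (p q : Scar) : Scar := (p.1, p.2 ++ q.1 :: q.2).
Definition SE (k l : nat) (p q : Scar) : Prop :=
  cong (relS k l) (p.1 :: p.2) (q.1 :: q.2).

(* Main.v *)
Require Import Defs.
From Corelib Require Import Setoid.
From mathcomp Require Import all_boot.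
Set Implicit Arguments. Unset Strict Implicit. Unset Printing Implicit Defensive.

(** If l <= 1, every element is represented by a word p a^m, where p is a product
    of blocks a^r b with r < k; p is unique, and m is unique (l = 1) or unique
    modulo k (l = 0). These words form a prefix-closed regular language, and right
    multiplication by a generator only changes the end of such a word.

    If l >= 2, S is not even automatic. The word a^(nk) (b a^k)^t b^(l-1) has no
    factor b^l, hence represents only itself, but multiplying it by b collapses
    it to b^(t+l). For n large, an automaton recognizing L_b has read the whole
    representative of b^(t+l) while still inside the initial power of a, so by
    the pigeonhole principle it confuses two values of t, which contradicts the
    invariance of the number of b's. *)

(** * Closure properties of regular languages *)

Section Regular.
Variable S : finType.
Implicit Types (L : seq S -> Prop) (w : seq S).

Lemma regular_ext L L' : (forall w, L w <-> L' w) -> regular L -> regular L'.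
Proof.
by move=> eL [Q [q [d [F H]]]]; exists Q, q, d, F => w; rewrite -eL.
Qed.

Lemma regularI L1 L2 :
  regular L1 -> regular L2 -> regular (fun w => L1 w /\ L2 w).
Proof.
move=> [Q1 [q1 [d1 [F1 H1]]]] [Q2 [q2 [d2 [F2 H2]]]].
exists (Q1 * Q2)%type, (q1, q2), (fun q x => (d1 q.1 x, d2 q.2 x)).
exists (fun q => F1 q.1 && F2 q.2) => w; rewrite H1 H2.
have -> : foldl (fun q x => (d1 q.1 x, d2 q.2 x)) (q1, q2) w
          = (foldl d1 q1 w, foldl d2 q2 w).
  by elim/last_ind: w => [|w x IH] //; rewrite !foldl_rcons IH.
by split=> [[-> ->]|/andP[]].
Qed.

Lemma regularC L : regular L -> regular (fun w => ~ L w).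
Proof.
move=> [Q [q [d [F H]]]]; exists Q, q, d, (fun q => ~~ F q) => w.
by rewrite H; split=> /negP.
Qed.

Lemma regularU L1 L2 :
  regular L1 -> regular L2 -> regular (fun w => L1 w \/ L2 w).
Proof.
move=> R1 R2.
apply: (regular_ext _ (regularC (regularI (regularC R1) (regularC R2)))) => w.
(* The acceptors decide membership, which removes the double negation left by De Morgan's law. *)
case: R1 R2 => [Q1 [q1 [d1 [F1 H1]]]] [Q2 [q2 [d2 [F2 H2]]]].
rewrite H1 H2; split=> [|[->|->] []//].
by case: (F1 _) => [|H]; [left|right; case: (F2 _) H => // -[]].
Qed.

Lemma regular_exists (I : finType) (L : I -> seq S -> Prop) :
  (forall i, regular (L i)) -> regular (fun w => exists i, L i w).
Proof.
move=> R.
have : regular (fun w => exists2 i, i \in enum I & L i w).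
  elim: (enum I) => [|i s IH].
    by exists unit, tt, (fun _ _ => tt), pred0 => w; split=> // -[].
  apply: regular_ext (regularU (R i) IH) => w; split.
    case=> [Lw|[j js Lw]]; first by exists i; rewrite ?mem_head.
    by exists j; rewrite ?inE ?js ?orbT.
  case=> j; rewrite inE => /orP[/eqP->|js] Lw; first by left.
  by right; exists j.
apply: regular_ext => w; split=> [[i _ Lw]|[i Lw]]; exists i => //.
by rewrite mem_enum.
Qed.

Lemma regular_all (a : pred S) : regular (fun w => all a w).
Proof.
exists bool, true, (fun q x => q && a x), id => w.
have -> : foldl (fun q x => q && a x) true w = all a w => [|//].
by elim/last_ind: w => [|w x IH] //; rewrite foldl_rcons IH all_rcons andbC.
Qed.

Lemma regular_nil : regular (fun w => w = [::]).
Proof. by apply: regular_ext (regular_all pred0) => -[]. Qed.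

Lemma regular_cons x L :
  regular L -> regular (fun w => exists2 u, w = x :: u & L u).
Proof.
move=> [Q [q [d [F H]]]].
(* [None] is the state before the first letter, [Some None] the sink after a wrong first letter. *)
pose step o y : option (option Q) := match o with
  | None => if y == x then Some (Some q) else Some None
  | Some None => Some None
  | Some (Some r) => Some (Some (d r y))
  end.
exists (option (option Q)), None, step.
exists (fun o => if o is Some (Some r) then F r else false) => w.
case: w => [|y w] /=; first by split=> // -[].
have dead v : foldl step (Some None) v = Some None by elim: v.
have run v r : foldl step (Some (Some r)) v = Some (Some (foldl d r v)).
  by elim: v r => //= z v IH r; rewrite IH.
case: eqP => [->|nyx]; last by rewrite dead; split=> // -[u [/nyx]].
by rewrite run -H; split=> [[u [->]]|Lw] //; exists w.
Qed.

Lemma regular_word v : regular (fun w => w = v).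
Proof.
elim: v => [|x v IH]; first exact: regular_nil.
by apply: regular_ext (regular_cons x IH) => w; split=> [[u -> ->]|->] //; exists v.
Qed.

Lemma regular_cat L1 L2 : regular L1 -> regular L2 ->
  regular (fun w => exists u v, [/\ w = u ++ v, L1 u & L2 v]).
Proof.
move=> [Q1 [q1 [d1 [F1 H1]]]] [Q2 [q2 [d2 [F2 H2]]]].
(* Subset construction: a run of the second automaton starts after each prefix that lies in [L1]. *)
pose start q : {set Q2} := if F1 q then [set q2] else set0.
pose step (q : Q1 * {set Q2}) x :=
  (d1 q.1 x, [set d2 y x | y in q.2] :|: start (d1 q.1 x)).
pose run w := foldl step (q1, start q1) w.
have run1 w : (run w).1 = foldl d1 q1 w.
  by elim/last_ind: w => // w x IH; rewrite /run !foldl_rcons /= -IH.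
have inst y q : reflect (F1 q /\ y = q2) (y \in start q).
  rewrite /start; case: ifP => F; rewrite inE; last by constructor => -[].
  by apply: (iffP eqP) => [|[]].
have run2 w y : y \in (run w).2 <->
    exists u v, [/\ w = u ++ v, F1 (foldl d1 q1 u) & foldl d2 q2 v = y].
  elim/last_ind: w y => [|w x IH] y.
    rewrite /run /=; split=> [/inst[F ->]|[u [v []]]]; first by exists [::], [::].
    by case: u v => [|//] [|//] _ F <-; apply/inst.
  have -> : (run (rcons w x)).2
      = [set d2 z x | z in (run w).2] :|: start (foldl d1 q1 (rcons w x)).
    by rewrite -run1 /run foldl_rcons.
  rewrite inE; split=> [/orP[/imsetP[z /IH[u [v [-> Fu <-]]] ->]|/inst[F ->]]|].
  - by exists u, (rcons v x); rewrite foldl_rcons rcons_cat.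
  - by exists (rcons w x), [::]; rewrite cats0.
  case=> u [v]; case/lastP: v => [|v z] [].
    by rewrite cats0 => <- F <-; apply/orP; right; apply/inst.
  rewrite -rcons_cat => /rcons_inj[ew <-] F <-; apply/orP; left.
  apply/imsetP; exists (foldl d2 q2 v); last by rewrite foldl_rcons.
  by apply/IH; exists u, v.
exists (Q1 * {set Q2})%type, (q1, start q1), step.
exists (fun q : Q1 * {set Q2} => [exists y in q.2, F2 y]) => w; split.
  case=> u [v [-> /H1 Fu /H2 Fv]]; apply/existsP; exists (foldl d2 q2 v).
  by rewrite Fv andbT; apply/run2; exists u, v.
case/existsP=> y /andP[/run2[u [v [-> Fu <-]]] Fv].
by exists u, v; split=> //; [apply/H1|apply/H2].
Qed.

Lemma regular_size_mod k c r : 0 < k -> regular (fun w => (size w + c) %% k = r).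
Proof.
case: k => // k _.
exists 'I_k.+1, (inord (c %% k.+1)).
exists (fun (i : 'I_k.+1) _ => inord (i.+1 %% k.+1)), (fun i : 'I_k.+1 => i == r :> nat).
move=> w.
have -> : val (foldl (fun (i : 'I_k.+1) _ => inord (i.+1 %% k.+1))
                 (inord (c %% k.+1)) w) = (size w + c) %% k.+1.
  elim/last_ind: w => [|w x IH]; first by rewrite /= inordK ?ltn_pmod.
  rewrite foldl_rcons /= inordK ?ltn_pmod // IH size_rcons addSn.
  by rewrite -addn1 modnDml addn1.
by split=> /eqP.
Qed.

End Regular.

(** Letters sent to [None] leave the state unchanged. With [fst] and [snd] this tests one component
    of a padded word. *)
Lemma regular_pmap (S S' : finType) (f : S -> option S') (L : seq S' -> Prop) :
  regular L -> regular (fun w => L (pmap f w)).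
Proof.
move=> [Q [q [d [F H]]]].
exists Q, q, (fun q x => if f x is Some y then d q y else q), F => w.
rewrite H; suff -> : foldl d q (pmap f w)
    = foldl (fun q x => if f x is Some y then d q y else q) q w by [].
by elim: w q {H} => //= x w IH r; case: (f x) => [y|] /=; rewrite IH.
Qed.

Lemma regular_map (S S' : finType) (f : S -> S') (g : S' -> option S)
    (L : seq S -> Prop) : pcancel f g ->
  regular L -> regular (fun w => exists2 u, L u & w = map f u).
Proof.
move=> fK RL.
apply: regular_ext (regularI (regular_pmap g RL)
  (regular_all (fun y => if g y is Some x then f x == y else false))) => w.
split=> [[Lw aw]|[u Lu ->]].
  exists (pmap g w) => //; elim: w aw {Lw} => //= y w IH /andP[].
  by case: (g y) => //= x /eqP-> /IH {1}->.
rewrite (map_pK fK); split=> //; elim: u {Lu} => //= x u ->.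
by rewrite fK eqxx.
Qed.

(** * Right-padded pairs of words *)

Local Arguments padR : simpl never.

Section Padding.
Variable A : finType.
Implicit Types u v p : seq A.

Lemma padR_cons x y u v : padR (x :: u) (y :: v) = (Some x, Some y) :: padR u v.
Proof. by rewrite /padR /mkseq /= maxnSS /= (iotaDl 1 0) -map_comp. Qed.

Lemma padR0 u : padR u [::] = [seq (Some x, None) | x <- u].
Proof.
rewrite /padR maxn0; elim: u => //= x u IH.
by rewrite /mkseq /= (iotaDl 1 0) -map_comp -IH; congr cons; apply: eq_map => i /=; rewrite !nth_nil.
Qed.

Lemma pad0R v : padR [::] v = [seq (None, Some x) | x <- v].
Proof.
rewrite /padR max0n; elim: v => //= x v IH.
by rewrite /mkseq /= (iotaDl 1 0) -map_comp -IH; congr cons; apply: eq_map => i /=; rewrite !nth_nil.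
Qed.

Lemma padR_catl p u v :
  padR (p ++ u) (p ++ v) = [seq (Some x, Some x) | x <- p] ++ padR u v.
Proof. by elim: p => //= x p IH; rewrite padR_cons IH. Qed.

(** Once [v] has ended, the tail [u'] meets only padding, so exchanging it does not affect what was
    read before. *)
Lemma padR_catr u u' v : size v <= size u ->
  padR (u ++ u') v = padR u v ++ padR u' [::].
Proof.
elim: u v => [|x u IH] [|y v] // le; rewrite ?padR0 ?map_cat //.
by rewrite cat_cons !padR_cons IH // padR0.
Qed.

Lemma padR_fst u v : pmap fst (padR u v) = u.
Proof.
elim: u v => [|x u IH] [|y v] //.
- by rewrite pad0R /=; elim: v.
- by rewrite padR0 /=; congr cons; elim: u {IH} => //= z u ->.
by rewrite padR_cons /= IH.
Qed.

Lemma padR_snd u v : pmap snd (padR u v) = v.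
Proof.
elim: v u => [|y v IH] [|x u] //.
- by rewrite padR0 /=; elim: u.
- by rewrite pad0R /=; congr cons; elim: v {IH} => //= z v ->.
by rewrite padR_cons /= IH.
Qed.

Lemma padR_inj u v u' v' : padR u v = padR u' v' -> u = u' /\ v = v'.
Proof.
by move=> e; rewrite -(padR_fst u v) -{2}(padR_snd u v) e padR_fst padR_snd.
Qed.

(** Padded pairs are a block of full letter pairs followed by a block padded throughout on one
    side. *)
Lemma regular_padR :
  regular (fun w : seq (option A * option A) => exists u v, w = padR u v).
Proof.
pose both (z : option A * option A) := isSome z.1 && isSome z.2.
pose lft (z : option A * option A) := isSome z.1 && ~~ isSome z.2.
pose rgt (z : option A * option A) := ~~ isSome z.1 && isSome z.2.
apply: regular_ext (regular_cat (regular_all both)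
  (regularU (regular_all lft) (regular_all rgt))) => w; split.
  case=> p [s [-> {w}]]; elim: p => [_|[[x|] [y|]] // p IH /= /IH{}IH sE] /=.
    case=> sE.
      exists (pmap fst s), [::]; rewrite padR0; elim: s sE => //= -[[x|] [y|]] //=.
      by move=> s IH /IH {1}->.
    exists [::], (pmap snd s); rewrite pad0R; elim: s sE => //= -[[x|] [y|]] //=.
    by move=> s IH /IH {1}->.
  by have [u [v ->]] := IH sE; exists (x :: u), (y :: v); rewrite padR_cons.
case=> u [v ->]; elim: u v => [|x u IH] [|y v].
- by exists [::], [::]; split=> //; left.
- exists [::], (padR [::] (y :: v)); split=> //; right.
  by rewrite pad0R all_map; apply/allP.
- exists [::], (padR (x :: u) [::]); split=> //; left.
  by rewrite padR0 all_map; apply/allP.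
have [w1 [w2 [e b c]]] := IH v.
by exists ((Some x, Some y) :: w1), w2; split=> //; rewrite padR_cons e.
Qed.

Lemma regular_padR_rect (X Y : seq A -> Prop) : regular X -> regular Y ->
  regular (fun w => exists u v, [/\ X u, Y v & w = padR u v]).
Proof.
move=> RX RY; apply: regular_ext (regularI regular_padR
  (regularI (regular_pmap fst RX) (regular_pmap snd RY))) => w; split.
  by case=> [[u [v ->]]]; rewrite padR_fst padR_snd => -[]; exists u, v.
case=> u [v [Xu Yv ->]]; rewrite padR_fst padR_snd.
by split=> //; exists u, v.
Qed.

(* Every relation of the automatic structure is, up to discarding empty words,
   a finite union of such rectangles behind a common prefix. *)
Lemma regular_padR_prefix (I : finType) (P : seq A -> Prop)
    (X Y : I -> seq A -> Prop) :
  regular P -> (forall i, regular (X i)) -> (forall i, regular (Y i)) ->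
  regular (fun w => exists u v, [/\ u <> [::], v <> [::], w = padR u v &
    exists p i x y, [/\ P p, X i x, Y i y, u = p ++ x & v = p ++ y]]).
Proof.
move=> RP RX RY.
(* By [padR_catl], a common prefix contributes diagonal letters only. *)
pose diag x : option A * option A := (Some x, Some x).
have diagK : pcancel diag fst by [].
have R i := regular_cat (regular_map diagK RP) (regular_padR_rect (RX i) (RY i)).
have Rn := regularC (regular_nil A).
apply: regular_ext (regularI (regularI (regular_pmap fst Rn) (regular_pmap snd Rn))
  (regular_exists R)) => w; split.
  case=> -[n1 n2] [i [w1 [w2 [e [p Pp e1] [x [y [Xx Yy e2]]]]]]].
  rewrite {}e1 {}e2 -padR_catl in e; exists (p ++ x), (p ++ y).
  move: n1 n2; rewrite {}e padR_fst padR_snd => n1 n2.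
  by split=> //; exists p, i, x, y.
case=> u [v [nu nv -> [p [i [x [y [Pp Xx Yy eu ev]]]]]]].
rewrite padR_fst padR_snd; split=> //; exists i.
exists (map diag p), (padR x y); rewrite eu ev padR_catl.
by split=> //; [exists p | exists x, y].
Qed.

End Padding.

(** * Words over an arbitrary generating set, spelled out over {a, b} *)

Section Words.
Variables (A : finType) (gen : A -> Scar).

Definition letter_word (x : A) : seq bool := (gen x).1 :: (gen x).2.
Definition spell (w : seq A) : seq bool := flatten (map letter_word w).

Lemma spell1 x : spell [:: x] = letter_word x.
Proof. by rewrite /spell /= cats0. Qed.

Lemma spell_cat u v : spell (u ++ v) = spell u ++ spell v.
Proof. by rewrite /spell map_cat flatten_cat. Qed.

Lemma phi_spell x w :
  exists2 t, phi Sop gen (x :: w) = Some t & t.1 :: t.2 = spell (x :: w).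
Proof.
exists (foldl (fun t a => Sop t (gen a)) (gen x) w) => //.
elim/last_ind: w => [|w y IH]; first by rewrite /spell /= cats0.
by rewrite foldl_rcons -rcons_cons -cats1 spell_cat -IH /spell /= cats0.
Qed.

Lemma wordeqP k l (u v : seq A) : wordeq Sop (SE k l) gen u v <->
  [/\ u <> [::], v <> [::] & cong (relS k l) (spell u) (spell v)].
Proof.
case: u v => [|x u] [|y v]; try by split=> // -[].
rewrite /wordeq; have [t -> <-] := phi_spell x u; have [s -> <-] := phi_spell y v.
by split=> [|[]].
Qed.

Lemma eqS_spell k l (u : seq A) t : eqS (SE k l) (phi Sop gen u) (Some t) <->
  u <> [::] /\ cong (relS k l) (spell u) (t.1 :: t.2).
Proof.
case: u => [|x u]; first by split=> // -[].
by have [s -> <-] := phi_spell x u; split=> [|[]].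
Qed.

Lemma size_spell_le (w : seq A) :
  size (spell w) <= size w * \max_x size (letter_word x).
Proof.
elim: w => // x w IH; rewrite -cat1s spell_cat !size_cat mulnDl leq_add //.
rewrite mul1n addn0.
exact: (leq_bigmax x).
Qed.

End Words.

(** * The congruence and its invariants *)

Section Congruence.
Variables (k l : nat).
Local Notation cg := (cong (relS k l)).

Lemma cong_ctx p s u v : cg u v -> cg (p ++ u ++ s) (p ++ v ++ s).
Proof.
elim=> {u v} [u|u v _|u v w _ H1 _ H2|u v r t R]; first exact: cong_refl.
- exact: cong_sym.
- exact: cong_trans H1 H2.
have e w : p ++ (r ++ w ++ t) ++ s = (p ++ r) ++ w ++ (t ++ s) by rewrite !catA.
by rewrite !e; apply: cong_step.
Qed.

Lemma cong_rel : cg (nseq k true ++ nseq l false) (nseq l false).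
Proof.
by have := @cong_step _ (relS k l) _ _ [::] [::] (conj erefl erefl);
  rewrite !cats0.
Qed.

Lemma cong_del n : cg (nseq (n * k) true ++ nseq l false) (nseq l false).
Proof.
elim: n => [|n IH]; first exact: cong_refl.
rewrite mulSn nseqD -catA; apply: cong_trans cong_rel.
by have := cong_ctx (nseq k true) [::] IH; rewrite !cats0.
Qed.

(** The relation inserts or erases letters a only; this invariant tells the powers of b apart. *)
Lemma cong_count u v : cg u v -> count_mem false u = count_mem false v.
Proof.
elim=> {u v} // [u v w _ -> _ ->|u v r s [-> ->]] //.
by rewrite !count_cat !count_nseq.
Qed.

(* Both sides of the relation contain b^l, so it cannot be applied to a word
   without this factor. *)
Lemma cong_rigid u v : cg u v -> ~~ infix (nseq l false) v -> u = v.
Proof.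
(* This symmetric disjunction, unlike the claim itself, passes through symmetry and transitivity. *)
move=> H; suff [//|[_ ->]//] : u = v \/
  (infix (nseq l false) u /\ infix (nseq l false) v).
elim: H => {u v} [u|u v _|u v w _ H1 _ H2|]; first by left.
- by case=> [->|[]]; [left|right].
- by case: H1 H2 => [->//|[iu iv]] [<-|[_ iw]]; right.
by move=> u v r s [-> ->]; right; rewrite -catA infix_infix catA infix_infix.
Qed.

End Congruence.

(** * No automatic structure when l is at least 2 *)

Section Nonautomatic.
Variables (k l : nat).
Hypotheses (k_gt0 : 0 < k) (l_gt1 : 1 < l).

Definition tower N t : seq bool :=
  nseq N true ++ flatten (nseq t (false :: nseq k true)) ++ nseq l.-1 false.

(** As k > 0, the blocks a^k separate the letters b into runs of length 1 or l-1, both below l. *)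
Lemma tower_infix N t : ~~ infix (nseq l false) (tower N t).
Proof.
have skip n s : infix (nseq l false) (nseq n true ++ s) = infix (nseq l false) s.
  by elim: n => //= n IH; rewrite IH; case: l l_gt1.
rewrite skip; elim: t => [|t IH] /=.
  by apply/negP=> /size_infix; rewrite !size_nseq; case: l l_gt1 => // m _; rewrite ltnn.
rewrite negb_or -catA skip IH andbT.
by case: l l_gt1 => [|[|m]] //; case: k k_gt0.
Qed.

Lemma tower_count N t : count_mem false (tower N t) = t + l.-1.
Proof.
rewrite !count_cat !count_nseq /= add0n mul1n; congr addn.
by elim: t => //= t IH; rewrite count_cat count_nseq IH.
Qed.

(* Appending one b makes the rightmost block of a's disappear, and this
   lengthens the following run of b's, which makes the next block disappear. *)
Lemma tower_collapse n t :
  cong (relS k l) (tower (n * k) t ++ [:: false]) (nseq (t + l) false).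
Proof.
have eb : nseq l.-1 false ++ [:: false] = nseq l false.
  by rewrite -[[:: false]]/(nseq 1 false) -nseqD addn1 prednK 1?ltnW.
rewrite -!catA eb.
have H : cong (relS k l) (flatten (nseq t (false :: nseq k true)) ++ nseq l false)
              (nseq (t + l) false).
  elim: t => [|t IH]; first exact: cong_refl.
  rewrite /= -catA.
  have := cong_ctx (false :: nseq k true) [::] IH; rewrite !cats0 /= => /cong_trans.
  (* The first l letters b of the collapsed suffix absorb the a^k before them. *)
  apply; have e : nseq (t + l) false = nseq l false ++ nseq t false by rewrite addnC nseqD.
  rewrite e catA.
  exact: (cong_ctx [:: false] (nseq t false) (cong_rel k l)).
(* The leading a's form a multiple of k and are absorbed as well. *)
have := cong_ctx (nseq (n * k) true) [::] H; rewrite !cats0 => /cong_trans; apply.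
rewrite addnC nseqD catA; exact: (cong_ctx [::] (nseq t false) (cong_del k l n)).
Qed.

Section Structure.
Variables (A : finType) (gen : A -> Scar) (L : seq A -> Prop).
Hypothesis HL : automatic_structure Sop (SE k l) gen L.

(** A representative of [w] spells a word congruent to [w], which by rigidity is [w] itself. *)
Lemma spell_rigid w : w <> [::] -> ~~ infix (nseq l false) w ->
  exists2 u, L u & spell gen u = w.
Proof.
case: w => // x w _ nw; have [_ _ surj _] := HL.
by have [u [Lu]] := surj (x, w); move=> /eqS_spell[_ /cong_rigid/(_ nw)]; exists u.
Qed.

(** For l > 1 the one-letter word b is rigid, and each generator spells at least one letter, so b is
    itself a generator. *)
Lemma letter_b : exists b, letter_word gen b = [:: false].
Proof.
have [//||u _] := @spell_rigid [:: false].
  by apply/negP=> /size_infix; rewrite size_nseq /= leqNgt l_gt1.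
case: u => // b u e; exists b; move: e; rewrite /spell /= /letter_word.
by case: (gen b) => x [|//] /= [->].
Qed.

Lemma not_automatic : False.
Proof.
have [b eb] := letter_b.
have [_ _ surj /(_ (Some b))[Q [q0 [d [F HQ]]]]] := HL.
(* One index more than there are states, for the pigeonhole principle. *)
pose T := 'I_#|Q|.+1.
have /fin_all_exists[beta Hbeta] (t : T) : exists u, L u /\
    cong (relS k l) (spell gen u) (nseq (t + l) false).
  have [u [Lu]] := surj (false, nseq (t + l).-1 false).
  move=> /eqS_spell[_ cu]; exists u; split=> //.
  by case: l l_gt1 cu => // m _; rewrite addnS.
(* [B] bounds the lengths of all [beta t]; [n] is so large that [B] generators spell fewer than nk
   letters. *)
pose B := \max_t size (beta t).
pose M := \max_x size (letter_word gen x).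
pose n := (B * M).+1.
have /fin_all_exists[alpha Halpha] (t : T) : exists u, L u /\
    spell gen u = tower (n * k) t.
  have [||u] := @spell_rigid (tower (n * k) t).
  - by rewrite /tower /n; case: k k_gt0.
  - exact: tower_infix.
  by exists u.
pose x t := take B (alpha t); pose y t := drop B (alpha t).
have short u : size u <= B -> size (spell gen u) < n * k.
  move=> su; apply: leq_trans (leq_pmulr n k_gt0); rewrite ltnS.
  by apply: leq_trans (size_spell_le gen u) _; rewrite leq_mul2r su orbT.
(* [alpha t] spells at least nk letters, so it has more than [B] generators and [x t] outlasts
   [beta t]. *)
have sizex t : size (beta t) <= size (x t).
  apply: (@leq_trans B); first exact: (leq_bigmax t).
  rewrite size_takel //.
  rewrite leqNgt; apply/negP=> /ltnW/short; rewrite (Halpha t).2.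
  by rewrite /tower size_cat size_nseq -ltn_subRL subnn.
(* [x t] spells a prefix of a^(nk), hence all letters b come from [y t]. *)
have countx t : count_mem false (spell gen (x t)) = 0.
  have lt : size (spell gen (x t)) < n * k by apply: short; rewrite size_take_min geq_minl.
  have := (Halpha t).2; rewrite -(cat_take_drop B (alpha t)) spell_cat -/(x t).
  move/(congr1 (take (size (spell gen (x t))))); rewrite take_size_cat // => ->.
  by rewrite /tower takel_cat ?size_nseq 1?ltnW // take_nseq 1?ltnW // count_nseq.
have county t : count_mem false (spell gen (y t)) = t + l.-1.
  rewrite -(tower_count (n * k)) -(Halpha t).2 -(cat_take_drop B (alpha t)).
  by rewrite spell_cat count_cat countx.
pose state t := foldl d q0 (padR (x t) (beta t)).
have [t [t' ntt' est]] : exists t, exists2 t', t <> t' & state t = state t'.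
  case: (boolP (injectiveb state)) => [/injectiveP inj|/injectivePn[t [t' /eqP]]].
    by have := leq_card state inj; rewrite card_ord ltnn.
  by exists t, t'.
(* After [x t] and [x t'] the states agree and both second words have ended, so [y t'] may follow
   [x t]. *)
have acc : F (foldl d q0 (padR (x t ++ y t') (beta t))).
  rewrite padR_catr // foldl_cat -/(state t) est /state -foldl_cat.
  rewrite -padR_catr //; apply/HQ.
  exists (alpha t'), (beta t'); rewrite /x /y cat_take_drop.
  have [[La ea] [Lb cb]] := (Halpha t', Hbeta t').
  split=> //; apply/wordeqP; split.
  - by rewrite /= ; case: (alpha t').
  - move=> e; move: cb; rewrite e => /cong_count; rewrite count_nseq /= mul1n.
    by case: l l_gt1 => // m _; rewrite addnS.
  rewrite /= -cats1 spell_cat ea spell1 eb.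
  by apply: cong_trans (cong_sym cb); apply: tower_collapse.
(* The hybrid word times b thus equals b^(t+l); counting letters b forces t = t'. *)
have [u [v [_ _ /wordeqP[_ _ ce] /padR_inj[eu ev]]]] := (HQ _).2 acc.
move: ce; rewrite -eu -ev /= => ce.
have := cong_count (cong_trans ce (Hbeta t).2).
rewrite -cats1 !spell_cat spell1 eb !count_cat countx county count_nseq /=.
move=> e; apply: ntt'; apply/val_inj/esym/eqP => /=.
have e' : t' + l = t + l by move: e; case: l l_gt1 => // m _ /=; rewrite !addnS !addn0 add0n mul1n.
by rewrite -(eqn_add2r l) e'.
Qed.

End Structure.
End Nonautomatic.

(** * Normal forms and the prefix-automatic structure for l at most 1 *)

Section Automatic.
Variables (k l : nat).
Hypotheses (k_gt0 : 0 < k) (l_le1 : l <= 1).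
Local Notation cg := (cong (relS k l)).

Inductive blocks : seq bool -> Prop :=
| blocks_nil : blocks [::]
| blocks_rcons p r : blocks p -> r < k -> blocks (p ++ nseq r true ++ [:: false]).

(* A pair (p, m) stands for the word p a^m; reading b reduces the pending
   exponent m modulo k. *)
Definition nf_step (s : seq bool * nat) (x : bool) : seq bool * nat :=
  if x then (s.1, s.2.+1) else (s.1 ++ nseq (s.2 %% k) true ++ [:: false], 0).

Definition nf (w : seq bool) := foldl nf_step ([::], 0) w.

Definition nf_word (s : seq bool * nat) : seq bool := s.1 ++ nseq s.2 true.

(** If l = 0 then a^k is trivial and the last exponent counts modulo k; if l = 1 no b follows it, so
    it is exact. *)
Definition nf_eq (s t : seq bool * nat) : Prop :=
  s.1 = t.1 /\ if l == 0 then s.2 = t.2 %[mod k] else s.2 = t.2.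

Lemma foldl_nf_nseq s m : foldl nf_step s (nseq m true) = (s.1, s.2 + m).
Proof.
elim: m s => [|m IH] [p n] /=; first by rewrite addn0.
by rewrite IH /= addSnnS.
Qed.

Lemma nf_blocks p m : blocks p -> nf (p ++ nseq m true) = (p, m).
Proof.
move=> Bp; suff e : nf p = (p, 0) by rewrite /nf foldl_cat -/(nf p) e foldl_nf_nseq.
elim: Bp => // {}p r _ e rk.
rewrite /nf !foldl_cat -/(nf p) e foldl_nf_nseq /= /nf_step /=.
by rewrite add0n modn_small.
Qed.

Lemma blocks_nf w : blocks (nf w).1.
Proof.
elim/last_ind: w => [|w x IH]; first exact: blocks_nil.
rewrite /nf foldl_rcons -/(nf w) /nf_step; case: x => //=.
by apply: blocks_rcons => //; rewrite ltn_pmod.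
Qed.

(** The last exponent is never reduced, even for l = 0, so that nonempty words keep nonempty
    representatives. *)
Lemma nf_nil w : nf_word (nf w) = [::] -> w = [::].
Proof.
elim/last_ind: w => // w x _; rewrite /nf foldl_rcons -/(nf w) /nf_step /nf_word.
by case: x => /(congr1 size); rewrite !size_cat ?size_nseq /= ?addnS // addn1 addnS.
Qed.

(** For l = 0 the powers of a^k vanish anywhere; for l = 1 the b on their right absorbs them. *)
Lemma cong_mod m : cg (nseq m true ++ [:: false]) (nseq (m %% k) true ++ [:: false]).
Proof.
rewrite {1}(divn_eq m k); case: l l_le1 (cong_del k l (m %/ k)) => [|[|//]] _.
  rewrite !cats0 => /(cong_ctx [::] (nseq (m %% k) true ++ [:: false])).
  by rewrite nseqD -catA.
rewrite addnC nseqD -catA => /(cong_ctx (nseq (m %% k) true) [::]).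
by rewrite !cats0.
Qed.

Lemma cong_nf w : cg w (nf_word (nf w)).
Proof.
elim/last_ind: w => [|w x IH]; first exact: cong_refl.
rewrite -cats1 /nf foldl_cat -/(nf w).
have /= := cong_ctx [::] [:: x] IH => /cong_trans; apply.
rewrite /nf_word /nf_step; case: x => /=.
  by rewrite -catA -[[:: true]]/(nseq 1 true) -nseqD addn1; apply: cong_refl.
have := cong_ctx (nf w).1 [::] (cong_mod (nf w).2).
by rewrite !cats0 !catA.
Qed.

Lemma nf_step_eq s t x : nf_eq s t -> nf_eq (nf_step s x) (nf_step t x).
Proof.
case: s t => [p m] [q n] [/= <-]; rewrite /nf_eq /nf_step; case: x => /=.
  case: eqP => _ e; split=> [//|]; last by rewrite e.
  by rewrite -(addn1 m) -(addn1 n) -modnDml e modnDml.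
by case: eqP => _ ->.
Qed.

(** Both sides of the relation lead from any pair to equivalent pairs, and later letters preserve
    the equivalence. *)
Lemma nf_cong u v : cg u v -> nf_eq (nf u) (nf v).
Proof.
elim=> {u v} [u|u v _|u v w _ H1 _ H2|u v r s [-> ->]].
- by rewrite /nf_eq; case: eqP.
- by rewrite /nf_eq; case: eqP => _ [-> ->].
- by move: H1 H2; rewrite /nf_eq; case: eqP => _ [-> ->].
have tail s1 s2 : nf_eq s1 s2 -> nf_eq (foldl nf_step s1 s) (foldl nf_step s2 s).
  by elim: s s1 s2 => //= x s IH s1 s2 /(@nf_step_eq _ _ x)/IH.
rewrite /nf !foldl_cat -/(nf r) foldl_nf_nseq; apply: tail.
rewrite /nf_eq; case: l l_le1 => [|[|//]] _ /=; first by rewrite modnDr.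
by rewrite /nf_step /= modnDr.
Qed.

Lemma congP u v : cg u v <-> nf_eq (nf u) (nf v).
Proof.
split=> [|E]; first exact: nf_cong.
apply: cong_trans (cong_nf u) _; apply: cong_sym; apply: cong_trans (cong_nf v) _.
apply: cong_sym; case: (nf u) (nf v) E => [p m] [q n] [/= <-]; rewrite /nf_word /=.
case: eqP => [l0|_ ->]; last exact: cong_refl.
have red i : cg (p ++ nseq i true) (p ++ nseq (i %% k) true).
  have := cong_ctx p (nseq (i %% k) true) (cong_del k l (i %/ k)).
  by have -> : nseq l false = [::]; [rewrite l0 | rewrite cats0 -nseqD -divn_eq].
by move=> e; apply: cong_trans (red m) _; rewrite e; apply: cong_sym.
Qed.

(** The state counts the current run of a's, with k as a sink; state 0 means that the last block is
    complete. *)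
Lemma regular_blocks : regular blocks.
Proof.
pose step (c : 'I_k.+1) (x : bool) : 'I_k.+1 :=
  if c == k :> nat then c else if x then inord c.+1 else ord0.
pose run w := foldl step ord0 w.
have runa n (c : 'I_k.+1) : c + n <= k -> foldl step c (nseq n true) = c + n :> nat.
  elim: n c => [|n IH] c; first by rewrite addn0.
  rewrite addnS => lt /=; have ck : c < k by apply: leq_ltn_trans lt; rewrite leq_addr.
  have e : step c true = c.+1 :> nat by rewrite /step ltn_eqF // inordK.
  by rewrite IH e addSn.
have stepb (c : 'I_k.+1) : c < k -> step c false = ord0.
  by rewrite /step => /ltn_eqF->.
exists 'I_k.+1, ord0, step, (fun c : 'I_k.+1 => c == 0 :> nat) => w; split.
  elim=> // p r _ /eqP/= IH rk; rewrite !foldl_cat -/(run p).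
  have e : foldl step (run p) (nseq r true) = r :> nat.
    by rewrite runa /run IH // add0n ltnW.
  by rewrite [foldl _ _ [:: _]]/= stepb ?e.
(* Outside the sink, the word read is a product of blocks followed by the counted run. *)
have inv v : run v < k -> exists2 p, blocks p & v = p ++ nseq (run v) true.
  elim/last_ind: v => [|v x IH]; first by exists [::] => //; exact: blocks_nil.
  rewrite /run foldl_rcons -/(run v) /step; case: eqP => [->|/eqP ne]; first by rewrite ltnn.
  have lt : run v < k by rewrite ltn_neqAle ne -ltnS ltn_ord.
  have [p Bp e] := IH lt; case: x => [_|_].
    exists p => //; rewrite inordK // {1}e -cats1 -catA -[[:: true]]/(nseq 1 true).
    by rewrite -nseqD addn1.
  exists (rcons v false); last by rewrite cats0.
  by rewrite e -cats1 -catA; apply: blocks_rcons.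
move=> /eqP r0; have [|p Bp e] := inv w; first by rewrite /run r0.
by rewrite e /run r0 cats0.
Qed.

Definition nf_lang (w : seq bool) : Prop :=
  exists2 p, blocks p & exists m, w = p ++ nseq m true.

Definition gen2 (x : bool) : Scar := (x, [::]).

Lemma spell_gen2 w : spell gen2 w = w.
Proof. by elim: w => //= x w {2}<-. Qed.

Lemma regular_as c r :
  regular (fun w : seq bool => exists2 m, w = nseq m true & (m + c) %% k = r).
Proof.
apply: regular_ext (regularI (regular_all (pred1 true))
  (regular_size_mod bool c r k_gt0)) => w; split.
  by case=> /all_pred1P e s; exists (size w).
by case=> m -> <-; rewrite size_nseq all_pred1_nseq.
Qed.

Lemma regular_nf_lang : regular nf_lang.
Proof.
apply: regular_ext (regular_cat regular_blocks (regular_all (pred1 true))) => w.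
split=> [[p [v [-> Bp /all_pred1P ->]]]|[p Bp [m ->]]].
  by exists p => //; exists (size v).
by exists p, (nseq m true); rewrite all_pred1_nseq.
Qed.

(** The empty word is removed because L lies in A^+; [nf_lang] keeps it and is closed under
    prefixes. *)
Definition nf_words (w : seq bool) : Prop := w <> [::] /\ nf_lang w.

Definition pending (x : option bool) (s : seq bool * nat) : seq bool * nat :=
  if x is Some y then nf_step s y else s.

(** [congP] and [nf_blocks] turn equality in the semigroup into a comparison of blocks and
    exponents. *)
Lemma Lpad_nf x w : Lpad Sop (SE k l) gen2 nf_words x w <->
  exists u v, [/\ u <> [::], v <> [::], w = padR u v &
    exists p m q n, [/\ blocks p, blocks q, u = p ++ nseq m true,
      v = q ++ nseq n true & nf_eq (pending x (p, m)) (q, n)]].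
Proof.
have nfa p m : blocks p -> nf (appl (p ++ nseq m true) x) = pending x (p, m).
  move=> Bp; case: x => [y|] /=; last exact: nf_blocks.
  by rewrite /nf foldl_rcons -/(nf _) nf_blocks.
split=> [[u [v [[nu [p Bp [m eu]]] [nv [q Bq [n ev]]]]]]|].
  rewrite eu ev => /wordeqP[_ _]; rewrite !spell_gen2 => /congP.
  rewrite nfa // nf_blocks // -eu -ev => E ->.
  by exists u, v; split=> //; exists p, m, q, n.
case=> u [v [nu nv -> [p [m [q [n [Bp Bq eu ev E]]]]]]].
exists u, v; split=> //; [by split=> //; exists p => //; exists m | |].
  by split=> //; exists q => //; exists n.
apply/wordeqP; split=> //; first by case: x {nfa E} => //= y; case: (u).
by rewrite !spell_gen2; apply/congP; rewrite eu ev nfa // nf_blocks.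
Qed.

Lemma regular_Lpad_nf x : regular (Lpad Sop (SE k l) gen2 nf_words x).
Proof.
have RB := regular_blocks; have RN := regular_nf_lang.
(* It remains to write the pairs as a common prefix followed by finitely many rectangles, in six
   cases: l = 0 or 1, and multiplication by a, b or the empty word. *)
have R (I : finType) (P : seq bool -> Prop) (X Y : I -> seq bool -> Prop) :
    regular P -> (forall i, regular (X i)) -> (forall i, regular (Y i)) ->
    (forall u v, (exists p i y z, [/\ P p, X i y, Y i z, u = p ++ y & v = p ++ z]) <->
      exists p m q n, [/\ blocks p, blocks q, u = p ++ nseq m true,
        v = q ++ nseq n true & nf_eq (pending x (p, m)) (q, n)]) ->
    regular (Lpad Sop (SE k l) gen2 nf_words x).
  move=> RP RX RY E; apply: regular_ext (regular_padR_prefix RP RX RY) => w.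
  by rewrite Lpad_nf; split=> -[u [v [nu nv -> /E H]]]; exists u, v.
have Rw v : regular (fun w : seq bool => w = v) := regular_word v.
have Ik m : m %% k < k by rewrite ltn_pmod.
rewrite /nf_eq in R *; case: eqP R => [l0|/eqP l1] R; case: x R => [[]|] R.
(* The index is the common residue of m+1 and n. *)
- apply: (R 'I_k blocks (fun i w => exists2 m, w = nseq m true & (m + 1) %% k = i)
    (fun i w => exists2 n, w = nseq n true & (n + 0) %% k = i)) => // [i|i|u v].
  + exact: regular_as.
  + exact: regular_as.
  split=> [[p [i [y [z [Bp [m -> em] [n -> en] -> ->]]]]]|].
    exists p, m, p, n; split=> //; split=> //=.
    by rewrite -addn1 em -en addn0.
  case=> p [m [q [n [Bp _ -> -> [/= <- e]]]]].
  exists p, (Ordinal (Ik m.+1)), (nseq m true), (nseq n true).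
  by split=> //; [exists m; rewrite // addn1 | exists n; rewrite // addn0].
(* The tails are a^m and a^i b a^n, where i is the residue of m and k divides n. *)
- apply: (R 'I_k blocks (fun i w => exists2 m, w = nseq m true & (m + 0) %% k = i)
    (fun i w => exists s t, [/\ w = s ++ t, s = nseq i true ++ [:: false] &
       exists2 n, t = nseq n true & (n + 0) %% k = 0])) => // [i|i|u v].
  + exact: regular_as.
  + exact: regular_cat (Rw _) (regular_as _ _).
  split=> [[p [i [y [z [Bp [m -> em] [_ [_ [-> -> [n -> en]]]] -> ->]]]]]|].
    exists p, m, (p ++ nseq i true ++ [:: false]), n; rewrite -!catA; split=> //.
      exact: blocks_rcons.
    by split=> /=; [rewrite -em addn0 | rewrite mod0n -en addn0].
  case=> p [m [q [n [Bp _ -> -> [/= <- e]]]]].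
  exists p, (Ordinal (Ik m)), (nseq m true),
    ((nseq (m %% k) true ++ [:: false]) ++ nseq n true).
  split=> //; rewrite -?catA //; first by exists m; rewrite // addn0.
  exists (nseq (m %% k) true ++ [:: false]), (nseq n true); rewrite -catA.
  by split=> //; exists n; rewrite // addn0 -e mod0n.
- apply: (R 'I_k blocks (fun i w => exists2 m, w = nseq m true & (m + 0) %% k = i)
    (fun i w => exists2 n, w = nseq n true & (n + 0) %% k = i)) => // [i|i|u v].
  + exact: regular_as.
  + exact: regular_as.
  split=> [[p [i [y [z [Bp [m -> em] [n -> en] -> ->]]]]]|].
    exists p, m, p, n; split=> //; split=> //=.
    by rewrite -[m]addn0 em -en addn0.
  case=> p [m [q [n [Bp _ -> -> [/= <- e]]]]].
  exists p, (Ordinal (Ik m)), (nseq m true), (nseq n true).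
  by split=> //; [exists m; rewrite // addn0 | exists n; rewrite // addn0].
(* For l = 1 the unbounded exponents must match exactly, so the a's join the common prefix. *)
- apply: (R unit nf_lang (fun _ w => w = [::]) (fun _ w => w = [:: true])) => // u v.
  split=> [[_ [[] [_ [_ [[p Bp [m ->]] -> -> -> ->]]]]]|].
    exists p, m, p, m.+1; rewrite cats0 -catA -[[:: true]]/(nseq 1 true) -nseqD addn1.
    by [].
  case=> p [m [q [n [Bp _ -> -> [/= <- <-]]]]].
  exists (p ++ nseq m true), tt, [::], [:: true]; rewrite cats0 -catA.
  rewrite -[[:: true]]/(nseq 1 true) -nseqD addn1.
  by split=> //; exists p => //; exists m.
(* The last b reduces m to its residue i, and nothing follows it. *)
- apply: (R 'I_k blocks (fun i w => exists2 m, w = nseq m true & (m + 0) %% k = i)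
    (fun i w => w = nseq i true ++ [:: false])) => // [i|u v].
  + exact: regular_as.
  split=> [[p [i [y [z [Bp [m -> em] -> -> ->]]]]]|].
    exists p, m, (p ++ nseq i true ++ [:: false]), 0; rewrite cats0; split=> //.
      exact: blocks_rcons.
    by split=> //=; rewrite -em addn0.
  case=> p [m [q [n [Bp _ -> -> [/= <- <-]]]]].
  exists p, (Ordinal (Ik m)), (nseq m true), (nseq (m %% k) true ++ [:: false]).
  by rewrite cats0; split=> //; exists m; rewrite // addn0.
- apply: (R unit nf_lang (fun _ w => w = [::]) (fun _ w => w = [::])) => // u v.
  split=> [[_ [[] [_ [_ [[p Bp [m ->]] -> -> -> ->]]]]]|].
    by exists p, m, p, m; rewrite cats0.
  case=> p [m [q [n [Bp _ -> -> [/= <- <-]]]]].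
  exists (p ++ nseq m true), tt, [::], [::]; rewrite cats0.
  by split=> //; exists p => //; exists m.
Qed.

(** Either an a leaves the final power, or the last block loses its b and becomes the final
    power. *)
Lemma nf_lang_rcons w x : nf_lang (rcons w x) -> nf_lang w.
Proof.
case=> p Bp [[|m]]; last first.
  rewrite -addn1 nseqD catA cats1 => /rcons_inj[-> _].
  by exists p => //; exists m.
rewrite cats0; case: Bp => [|{}p r Bp _]; first by case: (w).
by rewrite catA cats1 => /rcons_inj[-> _]; exists p => //; exists r.
Qed.

Lemma prefix_automatic_le1 : prefix_automatic Sop (SE k l).
Proof.
exists bool, gen2; split=> [x y /cong_count|]; first by case: x y => [] [].
exists nf_words; split.
  split=> [w []//| |[x w]|x]; last exact: regular_Lpad_nf.
    exact: regularI (regularC (regular_nil _)) regular_nf_lang.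
  exists (nf_word (nf (x :: w))); have ne : nf_word (nf (x :: w)) <> [::].
    by move=> /nf_nil.
  split; last first.
    by apply/eqS_spell; rewrite spell_gen2; split=> //; apply/cong_sym/cong_nf.
  split=> //; exists (nf (x :: w)).1; first exact: blocks_nf.
  by exists (nf (x :: w)).2.
have nf_pref p : prefL nf_words p -> nf_lang p.
  case=> s [_]; elim/last_ind: s => [|s x IH]; first by rewrite cats0.
  by rewrite -rcons_cat => /nf_lang_rcons.
(* Nonempty prefixes stay in the language, so the prefix language is the one for the empty word. *)
apply: regular_ext (regular_Lpad_nf None) => w; split.
  case=> u [v [Lu Lv E ->]]; exists u, v; split=> //.
  by exists [::]; rewrite cats0.
case=> u [p [Lu /nf_pref Lp E ->]]; exists u, p; split=> //; split=> //.
by have /wordeqP[] := E.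
Qed.
End Automatic.

Theorem theorem3p1p7 (k l : nat) :
  1 <= k -> (prefix_automatic Sop (SE k l) <-> l <= 1).
Proof.
move=> k_gt0; split=> [[A [gen [_ [L [HL _]]]]]|]; last exact: prefix_automatic_le1.
by rewrite leqNgt; apply/negP=> l_gt1; apply: not_automatic HL.
Qed.
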